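(* Let $\hat\mu=\boldsymbol\Phi_Y(\cdot)\,\boldsymbol F\,\boldsymbol\Phi_X(\cdot)^\top\in\mathcal H$ with $\boldsymbol F=(\boldsymbol K_X+n\lambda\boldsymbol I_n)^{-1}$, $\lambda>0$, be the empirical (full-rank) conditional mean embedding estimator, and let $$\tilde\mu=\boldsymbol\Phi_Y(\cdot)\,\boldsymbol Q_Y\tilde{\boldsymbol F}\boldsymbol Q_X^\top\,\boldsymbol\Phi_X(\cdot)^\top,\qquad \tilde{\boldsymbol F}=(\boldsymbol L_Y\boldsymbol V_Y)^\top(\boldsymbol L_X\boldsymbol V_X)(\boldsymbol\Lambda_X+n\lambda\boldsymbol I_{m_X})^{-1}\in\mathbb R^{m_Y\times m_X},$$ be the low-rank approximation, computed under the conditions $$\operatorname{trace}(\boldsymbol K_X-\boldsymbol L_X\boldsymbol L_X^\top)<\varepsilon\quad\text{and}\quad \operatorname{trace}(\boldsymbol K_Y-\boldsymbol L_Y\boldsymbol L_Y^\top)<\varepsilon .$$ Let $$\tilde{\mathcal H}=\operatorname{span}\big\{(\boldsymbol\Phi_X\boldsymbol Q_X)_i\otimes(\boldsymbol\Phi_Y\boldsymbol Q_Y)_j:\ i=1,\dots,m_X,\ j=1,\dots,m_Y\big\}\subset\mathcal H.$$ Then the orthogonal projection of $\hat\mu$ onto $\tilde{\mathcal H}$ is given by $$\hat\mu_{\tilde{\mathcal H}}=\boldsymbol\Phi_Y(\cdot)\,\boldsymbol Q_Y\boldsymbol F_{\tilde{\mathcal H}}\boldsymbol Q_X^\top\,\boldsymbol\Phi_X(\cdot)^\top$$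 with coefficient matrix $$\boldsymbol F_{\tilde{\mathcal H}}=\operatorname*{arg\,min}_{\boldsymbol F'\in\mathbb R^{m_Y\times m_X}}\big\|\hat\mu-\boldsymbol\Phi_Y(\cdot)\boldsymbol Q_Y\boldsymbol F'\boldsymbol Q_X^\top\boldsymbol\Phi_X(\cdot)^\top\big\|_{\mathcal H}^2=(\boldsymbol L_Y\boldsymbol V_Y)^\top\boldsymbol F\,\boldsymbol L_X\boldsymbol V_X .$$ Moreover, $$\|\hat\mu-\tilde\mu\|_{\mathcal H}^2\le\varepsilon\,\|\boldsymbol F\|_F^2\,\big(\operatorname{trace}(\boldsymbol K_X)+\operatorname{trace}(\boldsymbol K_Y)\big)+\|\boldsymbol F_{\tilde{\mathcal H}}-\tilde{\boldsymbol F}\|_F^2,$$ where $\|\cdot\|_F$ denotes the Frobenius norm.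
   Context: $\mathcal X,\mathcal Y$ are separable complete metric spaces; $\mathcal H_{\mathcal X},\mathcal H_{\mathcal Y}$ are separable real reproducing kernel Hilbert spaces of functions on $\mathcal X$, $\mathcal Y$ with reproducing kernels $k_{\mathcal X},k_{\mathcal Y}$, and $\mathcal H=\mathcal H_{\mathcal X}\otimes\mathcal H_{\mathcal Y}$ is the tensor product RKHS, with kernel $k((x,y),(x',y'))=k_{\mathcal X}(x,x')k_{\mathcal Y}(y,y')$. A finite sample $(x_i,y_i)\in\mathcal X\times\mathcal Y$, $i=1,\dots,n$, is given. Feature row vectors: $\boldsymbol\Phi_X(\cdot)=[k_{\mathcal X}(x_1,\cdot),\dots,k_{\mathcal X}(x_n,\cdot)]$ and $\boldsymbol\Phi_Y(\cdot)=[k_{\mathcal Y}(y_1,\cdot),\dots,k_{\mathcal Y}(y_n,\cdot)]$. Kernel matrices: $\boldsymbol K_X=[k_{\mathcal X}(x_i,x_j)]_{i,j=1}^n$, $\boldsymbol K_Y=[k_{\mathcal Y}(y_i,y_j)]_{i,j=1}^n$ (symmetric positive semidefinite). For $\boldsymbol M\in\mathbb R^{n\times n}$, the expression $\boldsymbol\Phi_Y(\cdot)\boldsymbol M\boldsymbol\Phi_X(\cdot)^\top$ denotes the element $\sum_{i,j}M_{ij}\,k_{\mathcal X}(x_j,\cdot)\otimes k_{\mathcal Y}(y_i,\cdot)$ of $\mathcal H$. Pivoted Cholesky decomposition of a symmetric positive semidefinite $\boldsymbol K\in\mathbb R^{n\times n}$ with tolerance $\varepsilon>0$: start with $\boldsymbol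 d=\operatorname{diag}(\boldsymbol K)$ and empty matrices $\boldsymbol L,\boldsymbol B$. While $\|\boldsymbol d\|_1$ exceeds the tolerance: choose an index $p$ maximizing $d_p$; put $\boldsymbol\ell=d_p^{-1/2}(\boldsymbol K-\boldsymbol L\boldsymbol L^\top)\boldsymbol e_p$ and $\boldsymbol b=d_p^{-1/2}(\boldsymbol I-\boldsymbol B\boldsymbol L^\top)\boldsymbol e_p$; append $\boldsymbol\ell$ as a new column to $\boldsymbol L$ and $\boldsymbol b$ to $\boldsymbol B$; replace $\boldsymbol d$ by $\boldsymbol d-\boldsymbol\ell\odot\boldsymbol\ell$ (entrywise product). The output $\boldsymbol L,\boldsymbol B\in\mathbb R^{n\times m}$ ($m\le\operatorname{rank}\boldsymbol K$) is known to satisfy: $\boldsymbol K-\boldsymbol L\boldsymbol L^\top$ is positive semidefinite, with trace at most the tolerance; $\operatorname{Im}\boldsymbol B=\operatorname{span}\{\boldsymbol e_{p_1},\dots,\boldsymbol e_{p_m}\}$ for the chosen pivots $p_1,\dots,p_m$; $\boldsymbol B^\top\boldsymbol L=\boldsymbol I_m$; and $\boldsymbol K\boldsymbol B=\boldsymbol L$. Applying this to $\boldsymbol K_X$ and $\boldsymbol K_Y$ separately gives $\boldsymbol L_X,\boldsymbol B_X\in\mathbb R^{n\times m_X}$ and $\boldsymbol L_Y,\boldsymbol B_Y\in\mathbb R^{n\times m_Y}$. Spectral decompositions $\boldsymbol V_X\boldsymbol\Lambda_X\boldsymbol V_X^\top=\boldsymbol L_X^\top\boldsymbol L_X$ and $\boldsymbol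 V_Y\boldsymbol\Lambda_Y\boldsymbol V_Y^\top=\boldsymbol L_Y^\top\boldsymbol L_Y$ are taken, with $\boldsymbol V_X,\boldsymbol V_Y$ orthogonal and $\boldsymbol\Lambda_X,\boldsymbol\Lambda_Y$ diagonal, and $\boldsymbol Q_X=\boldsymbol B_X\boldsymbol V_X$, $\boldsymbol Q_Y=\boldsymbol B_Y\boldsymbol V_Y$. $(\boldsymbol\Phi_X\boldsymbol Q_X)_i$ is the $i$-th entry of the row vector $\boldsymbol\Phi_X(\cdot)\boldsymbol Q_X$ of functions in $\mathcal H_{\mathcal X}$, and similarly for $Y$. *)

(* Defs.v *)
From HB Require Import structures.
From mathcomp Require Import all_boot all_order all_algebra.
From mathcomp Require Import all_classical all_reals all_analysis.
Set Implicit Arguments.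
Unset Strict Implicit.
Unset Printing Implicit Defensive.
Import Order.TTheory GRing.Theory Num.Theory.
Import numFieldNormedType.Exports.
Local Open Scope classical_set_scope.
Local Open Scope ring_scope.

#[short(type="completeMetricType")]
HB.structure Definition CompleteMetric (R : numDomainType) :=
  {T of Complete T & Metric R T}.

Definition separable_space (T : topologicalType) : Prop :=
  exists A : set T, countable A /\ dense A.

HB.mixin Record isHilbert (R : realType) H & CompleteNormedModule R H := {
  dot : {dot H for (@idfun R)};
  sqr_norm_dot : forall u : H, `|u| ^+ 2 = dot u u
}.

#[short(type="hilbertType")]
HB.structure Definition Hilbert (R : realType) :=
  {H of CompleteNormedModule R H & isHilbert R H}.

(* The elements of [H] are identified with functions on [X] through the
   injective map [feval]; its linearity is a consequence of [reproducing].
   [ksec x] is the element k(x, -) of [H]. *)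
HB.mixin Record isRKHS (R : realType) (X : Type) H & Hilbert R H := {
  feval : H -> X -> R;
  feval_inj : injective feval;
  ksec : X -> H;
  reproducing : forall (f : H) (x : X), feval f x = dot f (ksec x)
}.

#[short(type="rkhsType")]
HB.structure Definition RKHS (R : realType) (X : Type) :=
  {H of Hilbert R H & isRKHS R X H}.

Definition rkernel (R : realType) (X : Type) (H : rkhsType R X)
    (x x' : X) : R :=
  feval (ksec x : H) x'.

Definition lin_span (R : realType) (V : lmodType R) (A : set V) : set V :=
  [set v | exists (k : nat) (c : 'I_k -> R) (a : 'I_k -> V),
     (forall i, A (a i)) /\ v = \sum_(i < k) c i *: a i].

(* Hilbert space tensor product, realized as functions by
   (f \otimes g)(x, y) = f(x) g(y). *)
Record is_tensor_rkhs (R : realType) (X Y : Type) (HX : rkhsType R X)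
    (HY : rkhsType R Y) (H : rkhsType R (X * Y)%type) (tens : HX -> HY -> H) :
    Prop := {
  tens_feval : forall f g x y,
    feval (tens f g) (x, y) = feval f x * feval g y;
  tens_dot : forall f f' g g',
    dot (tens f g) (tens f' g') = dot f f' * dot g g';
  tens_dense : dense (lin_span [set tens f g | f in [set: HX] & g in [set: HY]])
}.

Lemma dotC (R : realType) (H : hilbertType R) (u v : H) : dot u v = dot v u.
Proof. by rewrite hermitian_subproof expr0 mul1r. Qed.

Lemma rkernelE (R : realType) (X : Type) (H : rkhsType R X) (x x' : X) :
  rkernel H x x' = dot (ksec x : H) (ksec x').
Proof. exact: reproducing. Qed.

Lemma tensor_ksec (R : realType) (X Y : Type) (HX : rkhsType R X)
    (HY : rkhsType R Y) (H : rkhsType R (X * Y)%type) (tens : HX -> HY -> H) :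
  is_tensor_rkhs tens -> forall x y, ksec (x, y) = tens (ksec x) (ksec y).
Proof.
move=> tP x y; apply/eqP; rewrite -subr_eq0; apply/eqP; set e := _ - _.
have e_tens f g : dot e (tens f g) = 0.
  rewrite dotC linearB /= -reproducing (tens_feval tP) (tens_dot tP).
  by rewrite -!reproducing subrr.
clearbody e; apply: contrapT => /eqP e_neq0.
have e_gt0 : 0 < `|e| by rewrite normr_gt0.
have [|v [eBv [k [c [a [aT vE]]]]]] := tens_dense tP _ (ball_open e `|e|).
  by exists e; exact: ballxx.
have ev0 : dot e v = 0.
  rewrite vE linear_sum big1// => i _.
  by have [f _ [g _ <-]] := aT i; rewrite linearZ /= e_tens mulr0.
have : `|e - v| ^+ 2 < `|e| ^+ 2.
  by rewrite ltr_pXn2r ?nnegrE //; move: eBv; rewrite -ball_normE.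
apply/negP; rewrite -leNgt !sqr_norm_dot linearB /= ![dot (e - v) _]dotC.
rewrite !linearB /= ev0 [dot v e]dotC ev0 subr0 oppr0 opprK add0r lerDl.
by rewrite -sqr_norm_dot exprn_ge0.
Qed.

Lemma tensor_rkernel (R : realType) (X Y : Type) (HX : rkhsType R X)
    (HY : rkhsType R Y) (H : rkhsType R (X * Y)%type) (tens : HX -> HY -> H) :
  is_tensor_rkhs tens -> forall x x' y y',
  rkernel H (x, y) (x', y') = rkernel HX x x' * rkernel HY y y'.
Proof.
by move=> tP x x' y y'; rewrite !rkernelE !(tensor_ksec tP) (tens_dot tP).
Qed.

Definition kernel_mx (R : realType) (n : nat) (X : Type) (HX : rkhsType R X)
    (x : 'I_n -> X) : 'M[R]_n :=
  \matrix_(i, j) rkernel HX (x i) (x j).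

Definition feature_row (R : realType) (n : nat) (X : Type) (HX : rkhsType R X)
    (x : 'I_n -> X) (m : nat) (Q : 'M[R]_(n, m)) : 'I_m -> HX :=
  fun i => \sum_(k < n) Q k i *: ksec (x k).

Definition feature_form (R : realType) (n : nat) (X Y : Type)
    (HX : rkhsType R X) (HY : rkhsType R Y) (H : rkhsType R (X * Y)%type)
    (tens : HX -> HY -> H) (x : 'I_n -> X) (y : 'I_n -> Y) (M : 'M[R]_n) : H :=
  \sum_(i < n) \sum_(j < n) M i j *: tens (ksec (x j)) (ksec (y i)).

(* [pchol_steps K tol L B d]: from the initial state, the loop can reach [L],
   [B] and the current diagonal [d]; ties between pivots are broken
   arbitrarily. *)
Inductive pchol_steps (R : realType) (n : nat) (K : 'M[R]_n) (tol : R) :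
    forall m : nat, 'M[R]_(n, m) -> 'M[R]_(n, m) -> 'cV[R]_n -> Prop :=
| pchol_init :
    pchol_steps K tol (0 : 'M[R]_(n, 0)) (0 : 'M[R]_(n, 0)) (\col_i K i i)
| pchol_step (m : nat) (L B : 'M[R]_(n, m)) (d : 'cV[R]_n) (p : 'I_n) :
    let l :=
      (Num.sqrt (d p 0))^-1 *: ((K - L *m L^T) *m (delta_mx p 0 : 'cV[R]_n)) in
    let b :=
      (Num.sqrt (d p 0))^-1 *: ((1%:M - B *m L^T) *m
                                  (delta_mx p 0 : 'cV[R]_n)) in
    pchol_steps K tol L B d ->
    tol < \sum_i `|d i 0| ->
    (forall i, d i 0 <= d p 0) ->
    pchol_steps K tol (row_mx L l) (row_mx B b) (d - \col_i (l i 0 * l i 0)).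

Definition pivoted_cholesky (R : realType) (n m : nat) (K : 'M[R]_n) (tol : R)
    (L B : 'M[R]_(n, m)) : Prop :=
  exists d : 'cV[R]_n, pchol_steps K tol L B d /\ \sum_i `|d i 0| <= tol.

Definition spectral_decomposition (R : realType) (m : nat) (A V : 'M[R]_m)
    (Lam : 'rV[R]_m) : Prop :=
  V^T *m V = 1%:M /\ V *m diag_mx Lam *m V^T = A.

(* The library norm on matrices is the maximum norm. *)
Definition frobenius_norm (R : realType) (m n : nat) (M : 'M[R]_(m, n)) : R :=
  Num.sqrt (\sum_i \sum_j M i j ^+ 2).

Definition orthogonal_projection (R : realType) (H : hilbertType R) (S : set H)
    (u p : H) : Prop :=
  S p /\ forall s, S s -> dot (u - p) s = 0.

Definition argmin (R : realType) (T : Type) (f : T -> R) : set T :=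
  [set t | forall t', f t <= f t'].

(* Main.v *)
(** With [Q = B V] one has [K Q = L V] and [Q^T K Q = I], so that
    [<Phi M, Phi N> = tr (M^T K_Y N K_X)] makes [G |-> Phi (Q_Y G Q_X^T)] an
    isometry from the matrices with the Frobenius norm onto the subspace, and
    the inner product of [muhat] with the image of [G] is [<FH, G>_F].  This
    gives the projection and the minimizer.  By Pythagoras the error is
    [|muhat|^2 - |FH|_F^2 + |FH - Ft|_F^2], and [|muhat|^2 - |FH|_F^2] equals
    [tr (F^T (K_Y - L_Y L_Y^T) F K_X) + tr (F^T L_Y L_Y^T F (K_X - L_X L_X^T))],
    where both terms are bounded by [tr (A B) <= tr A * tr B] for positive
    semidefinite [A] and [B]. *)
Require Import Defs.
From mathcomp Require Import all_boot all_order all_algebra.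
From mathcomp Require Import all_classical all_reals all_analysis.
From mathcomp Require Import ring lra.
Import Order.TTheory GRing.Theory Num.Theory.
Import numFieldNormedType.Exports.
Local Open Scope classical_set_scope.
Local Open Scope ring_scope.

(** * Positive semidefinite matrices and a trace inequality *)

Definition psd {R : realType} {n : nat} (A : 'M[R]_n) : Prop :=
  A^T = A /\ forall u : 'cV[R]_n, 0 <= (u^T *m A *m u) 0 0.

Lemma psd_congr {R : realType} {m n : nat} {A : 'M[R]_n} (P : 'M[R]_(n, m)) :
  psd A -> psd (P^T *m A *m P).
Proof.
case=> symA posA; split=> [|u]; first by rewrite !trmx_mul trmxK symA mulmxA.
by have := posA (P *m u); rewrite trmx_mul !mulmxA.
Qed.

Lemma psd_mul_tr {R : realType} {m n : nat} (L : 'M[R]_(m, n)) :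
  psd (L *m L^T).
Proof.
split=> [|u]; first by rewrite trmx_mul trmxK.
have -> : u^T *m (L *m L^T) *m u = (L^T *m u)^T *m (L^T *m u).
  by rewrite trmx_mul trmxK !mulmxA.
by rewrite mxE sumr_ge0// => i _; rewrite mxE -expr2 sqr_ge0.
Qed.

(** This is the quadratic form of [A] at [s e_i + t e_j], its two cross terms merged by symmetry;
    suitable [s] and [t] give the bounds on single entries. *)
Lemma psd_delta2 {R : realType} {n : nat} {A : 'M[R]_n} (i j : 'I_n) (s t : R) :
  psd A -> 0 <= s ^+ 2 * A i i + 2 * s * t * A i j + t ^+ 2 * A j j.
Proof.
case=> symA /(_ (s *: delta_mx i 0 + t *: delta_mx j 0)).
have Aji : A j i = A i j by rewrite -{1}symA mxE.
have form k l : (delta_mx k 0)^T *m A *m delta_mx l (0 : 'I_1) = (A k l)%:M.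
  by apply/matrixP=> a b; rewrite !ord1 trmx_delta -rowE -colE !mxE mulr1n.
have -> : (s *: delta_mx i 0 + t *: delta_mx j 0 : 'cV[R]_n)^T =
    s *: (delta_mx i 0)^T + t *: (delta_mx j 0)^T.
  by rewrite linearD !linearZ.
rewrite !mulmxDl !mulmxDr -!scalemxAl -!scalemxAr !form.
rewrite !mxE !mulr1n Aji; congr (0 <= _); ring.
Qed.

Lemma psd_diag_ge0 {R : realType} {n : nat} {A : 'M[R]_n} (i : 'I_n) :
  psd A -> 0 <= A i i.
Proof.
move=> /(psd_delta2 i i 1 0).
by rewrite expr1n expr0n mul1r mulr0 !mul0r !addr0.
Qed.

Lemma psd_tr_ge0 {R : realType} {n : nat} {A : 'M[R]_n} :
  psd A -> 0 <= \tr A.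
Proof. by move=> psdA; apply: sumr_ge0 => i _; exact: psd_diag_ge0. Qed.

Lemma psd_sqr_le {R : realType} {n : nat} {A : 'M[R]_n} (i j : 'I_n) :
  psd A -> A i j ^+ 2 <= A i i * A j j.
Proof.
move=> psdA; have := psd_diag_ge0 j psdA; rewrite le_eqVlt => /predU1P[Ajj|Ajj].
  (* When [A j j = 0], these weights make the form equal to [- A i j ^+ 2], so [A i j] vanishes. *)
  have := psd_delta2 i j (A i j) (- (A i i + 1) / 2) psdA.
  rewrite -Ajj => H; have -> : A i i * 0 = 0 by rewrite mulr0.
  by move: H; set a := A i j; set c := A i i; nra.
(* These weights make the form [A j j] times the 2 x 2 principal minor. *)
have := psd_delta2 i j (A j j) (- A i j) psdA.
have -> : A j j ^+ 2 * A i i + 2 * A j j * - A i j * A i j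
    + (- A i j) ^+ 2 * A j j = A j j * (A i i * A j j - A i j ^+ 2) by ring.
by rewrite pmulr_rge0// subr_ge0.
Qed.

(** The bound holds entry by entry: [A i j * B i j] is at most the mean of [A i i * B j j] and
    [A j j * B i i], and these means sum to the product of the traces. *)
Lemma psd_trM_le {R : realType} {n : nat} {A B : 'M[R]_n} :
  psd A -> psd B -> \tr (A *m B) <= \tr A * \tr B.
Proof.
move=> psdA psdB.
have -> : \tr A * \tr B =
    \sum_i \sum_j 2^-1 * (A i i * B j j + A j j * B i i).
  have -> : \tr A * \tr B = \sum_i \sum_j A i i * B j j.
    by rewrite mulr_suml; apply: eq_bigr => i _; rewrite mulr_sumr.
  under [RHS]eq_bigr => i _ do rewrite -mulr_sumr big_split.
  rewrite -mulr_sumr big_split/= [X in _ + X]exchange_big/=; lra.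
apply: ler_sum => i _; rewrite mxE; apply: ler_sum => j _.
have -> : B j i = B i j by rewrite -{1}psdB.1 mxE.
(* Squares are compared, which avoids roots: the squared mean exceeds the product of the four
   diagonal entries by a square. *)
have AMGM : (A i j * B i j) ^+ 2 <=
    (2^-1 * (A i i * B j j + A j j * B i i)) ^+ 2.
  have -> : (2^-1 * (A i i * B j j + A j j * B i i)) ^+ 2 =
      (A i i * A j j) * (B i i * B j j) +
      (2^-1 * (A i i * B j j - A j j * B i i)) ^+ 2 by field.
  by rewrite ler_wpDr ?sqr_ge0// exprMn ler_pM ?sqr_ge0 ?psd_sqr_le.
have : 0 <= A i i * B j j + A j j * B i i.
  by rewrite addr_ge0 ?mulr_ge0 ?psd_diag_ge0.
move: AMGM; set a := A i j * B i j; set c := _ + _; nra.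
Qed.

(** * Invariants of the pivoted Cholesky loop *)

Lemma tr_one_sub_mul {R : realType} {n m : nat} (B L : 'M[R]_(n, m)) :
  (1%:M - B *m L^T)^T = 1%:M - L *m B^T.
Proof. by rewrite linearB /= trmx1 trmx_mul trmxK. Qed.

(** The residual is the congruence of [K] by [1 - B L^T], since [K B = L] and [L^T B = 1]. *)
Lemma psd_residual {R : realType} {n m : nat} {K : 'M[R]_n}
    {L B : 'M[R]_(n, m)} :
  psd K -> K *m B = L -> B^T *m L = 1%:M -> psd (K - L *m L^T).
Proof.
move=> psdK KB BL.
have BK : B^T *m K = L^T by rewrite -KB trmx_mul psdK.1.
have LB : L^T *m B = 1%:M by rewrite -[RHS]trmx1 -BL trmx_mul trmxK.
have -> : K - L *m L^T = (1%:M - B *m L^T)^T *m K *m (1%:M - B *m L^T).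
  rewrite tr_one_sub_mul mulmxBl mul1mx -mulmxA BK.
  rewrite mulmxBr mulmx1 mulmxBl mulmxA KB -!mulmxA [L^T *m (B *m _)]mulmxA LB.
  by rewrite mul1mx subrr subr0.
exact: psd_congr.
Qed.

(** Induction on the loop. The first two invariants make the residual positive semidefinite; with
    [d] as its diagonal, this yields a positive pivot, so the division by its root is sound. *)
Lemma pchol_steps_inv {R : realType} {n m : nat} {K : 'M[R]_n} {tol : R}
    {L B : 'M[R]_(n, m)} {d : 'cV[R]_n} :
  psd K -> 0 <= tol -> pchol_steps K tol L B d ->
  [/\ K *m B = L, B^T *m L = 1%:M & d = \col_i (K - L *m L^T) i i].
Proof.
move=> psdK tol_ge0; elim=> [|{}m {}L {}B {}d p l b _].
  split; first by rewrite mulmx0.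
    by apply/matrixP => -[].
  by apply/colP => i; rewrite !mxE big_ord0 subr0.
move=> [KB BL dE] tol_lt d_max; have psdS := psd_residual psdK KB BL.
have dpE : (K - L *m L^T) p p = d p 0 by rewrite dE [RHS]mxE.
(* A nonpositive maximum of the nonnegative entries of [d] would make [d] zero, against the loop
   condition. *)
have dp_gt0 : 0 < d p 0.
  rewrite ltNge; apply/negP => dp_le0; move: tol_lt; apply/negP.
  rewrite -leNgt (le_trans _ tol_ge0)// big1// => i _.
  apply/eqP; rewrite normr_eq0 eq_le (le_trans (d_max i))//=.
  by rewrite dE mxE psd_diag_ge0.
have BK : B^T *m K = L^T by rewrite -KB trmx_mul psdK.1.
have Kb : K *m b = l.
  by rewrite /b /l -scalemxAr mulmxA mulmxBr mulmx1 mulmxA KB.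
have bT : b^T = (Num.sqrt (d p 0))^-1 *:
    ((delta_mx p 0 : 'cV[R]_n)^T *m (1%:M - L *m B^T)).
  by rewrite /b linearZ /= trmx_mul tr_one_sub_mul.
have bL : b^T *m L = 0.
  by rewrite bT -scalemxAl -mulmxA mulmxBl mul1mx -mulmxA BL mulmx1 subrr mulmx0
    scaler0.
have Bl : B^T *m l = 0.
  by rewrite /l -scalemxAr mulmxA mulmxBr BK mulmxA BL mul1mx subrr mul0mx
    scaler0.
(* Both scalings together contribute [1 / d_p], and what remains is the pivot entry of the residual,
   which is [d_p]. *)
have bl : b^T *m l = 1%:M.
  have -> : b^T *m l =
      (Num.sqrt (d p 0))^-1 *: ((delta_mx p (0 : 'I_1))^T *m l).
    by rewrite bT -scalemxAl -mulmxA mulmxBl mul1mx -mulmxA Bl mulmx0 subr0.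
  rewrite /l -scalemxAr scalerA -invfM -expr2 sqr_sqrtr ?ltW//.
  apply/matrixP => i j; rewrite !ord1 trmx_delta -colE -rowE !mxE /=.
  by move: dpE; rewrite !mxE => ->; rewrite mulVf ?gt_eqF.
split.
- by rewrite mul_mx_row KB Kb.
- by rewrite tr_row_mx mul_col_row BL bL Bl bl -scalar_mx_block.
- rewrite tr_row_mx mul_row_col opprD addrA dE; apply/colP => i.
  by rewrite !mxE big_ord1 !mxE.
Qed.

Lemma pivoted_cholesky_inv {R : realType} {n m : nat} {K : 'M[R]_n} {tol : R}
    {L B : 'M[R]_(n, m)} :
  psd K -> 0 <= tol -> pivoted_cholesky K tol L B ->
  K *m B = L /\ B^T *m L = 1%:M.
Proof. by move=> psdK tol0 [d [/(pchol_steps_inv psdK tol0)[]]]. Qed.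

(** * Inner products, kernel matrices and the Frobenius norm *)

Lemma dotBr {R : realType} {H : hilbertType R} (u v w : H) :
  dot u (v - w) = dot u v - dot u w.
Proof. exact: linearB. Qed.

Lemma dotZr {R : realType} {H : hilbertType R} (a : R) (u v : H) :
  dot u (a *: v) = a * dot u v.
Proof. exact: linearZ. Qed.

Lemma dotZl {R : realType} {H : hilbertType R} (a : R) (u v : H) :
  dot (a *: u) v = a * dot u v.
Proof. by rewrite dotC dotZr dotC. Qed.

Lemma dot_sumr {R : realType} {H : hilbertType R} {I : finType} (u : H)
    (F : I -> H) : dot u (\sum_i F i) = \sum_i dot u (F i).
Proof. exact: linear_sum. Qed.

Lemma dot_suml {R : realType} {H : hilbertType R} {I : finType} (F : I -> H)
    (v : H) : dot (\sum_i F i) v = \sum_i dot (F i) v.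
Proof. by rewrite dotC dot_sumr; apply: eq_bigr => i _; rewrite dotC. Qed.

Lemma kernel_mx_psd {R : realType} {n : nat} {X : Type} (HX : rkhsType R X)
    (x : 'I_n -> X) : psd (kernel_mx HX x).
Proof.
split=> [|u]; first by apply/matrixP => i j; rewrite !mxE !rkernelE dotC.
have -> : (u^T *m kernel_mx HX x *m u) 0 0 =
    dot (\sum_i u i 0 *: ksec (x i) : HX) (\sum_i u i 0 *: ksec (x i)).
  rewrite dot_sumr mxE; apply: eq_bigr => j _ /=.
  rewrite dot_suml mxE mulr_suml; apply: eq_bigr => i _.
  by rewrite dotZr dotZl !mxE rkernelE mulrC.
by rewrite -sqr_norm_dot sqr_ge0.
Qed.

Lemma frobenius_norm_sqr {R : realType} {m n : nat} (M : 'M[R]_(m, n)) :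
  frobenius_norm M ^+ 2 = \tr (M^T *m M).
Proof.
rewrite sqr_sqrtr; last by do 2! [apply: sumr_ge0 => ? _]; rewrite sqr_ge0.
rewrite exchange_big; apply: eq_bigr => j _ /=.
by rewrite mxE; apply: eq_bigr => i _; rewrite mxE expr2.
Qed.

Lemma frobenius_norm_eq0 {R : realType} {m n : nat} (M : 'M[R]_(m, n)) :
  frobenius_norm M ^+ 2 <= 0 -> M = 0.
Proof.
rewrite sqr_sqrtr; last by do 2! [apply: sumr_ge0 => ? _]; rewrite sqr_ge0.
move=> le0; apply/matrixP => i j; rewrite mxE; apply/eqP.
rewrite -sqrf_eq0 eq_le sqr_ge0 andbT (le_trans _ le0)//.
rewrite (bigD1 i)//= (bigD1 j)//= -addrA lerDl addr_ge0//.
  by apply: sumr_ge0 => ? _; rewrite sqr_ge0.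
by do 2! [apply: sumr_ge0 => ? _]; rewrite sqr_ge0.
Qed.

(** Two uses of [psd_trM_le]: first on [F^T A F] and [K], then, after a cyclic shift, on [A] and
    [F F^T]. *)
Lemma psd_tr_sandwich_le {R : realType} {n : nat} {A K : 'M[R]_n}
    (F : 'M[R]_n) :
  psd A -> psd K ->
  \tr (F^T *m A *m F *m K) <= \tr A * frobenius_norm F ^+ 2 * \tr K.
Proof.
move=> psdA psdK; apply: le_trans (psd_trM_le (psd_congr F psdA) psdK) _.
rewrite ler_wpM2r ?psd_tr_ge0// -mulmxA mxtrace_mulC -mulmxA.
rewrite frobenius_norm_sqr [\tr (F^T *m F)]mxtrace_mulC.
exact: psd_trM_le psdA (psd_mul_tr F).
Qed.

Lemma sqr_normD {R : realType} {H : hilbertType R} (u v : H) :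
  `|u + v| ^+ 2 = `|u| ^+ 2 + 2 * dot u v + `|v| ^+ 2.
Proof.
rewrite !sqr_norm_dot linearD /= ![dot (u + v) _]dotC !linearD /= [dot v u]dotC.
by ring.
Qed.

(** * Gram formula and low-rank form of feature expansions *)

Section Features.
Context {R : realType} {X Y : Type} {HX : rkhsType R X} {HY : rkhsType R Y}.
Context {H : rkhsType R (X * Y)%type} {tens : HX -> HY -> H}.
Context (tensP : is_tensor_rkhs tens).
Context {n : nat} (x : 'I_n -> X) (y : 'I_n -> Y).

Lemma feature_formB (M N : 'M[R]_n) :
  feature_form tens x y (M - N) =
  feature_form tens x y M - feature_form tens x y N.
Proof.
rewrite /feature_form -sumrB; apply: eq_bigr => i _; rewrite -sumrB.
by apply: eq_bigr => j _; rewrite !mxE scalerBl.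
Qed.

Lemma dot_feature_form (M N : 'M[R]_n) :
  dot (feature_form tens x y M) (feature_form tens x y N) =
  \tr (M^T *m kernel_mx HY y *m N *m kernel_mx HX x).
Proof.
have -> : \tr (M^T *m kernel_mx HY y *m N *m kernel_mx HX x) =
   \sum_i \sum_j M i j * (kernel_mx HY y *m N *m kernel_mx HX x) i j.
  rewrite -!mulmxA exchange_big; apply: eq_bigr => j _.
  by rewrite mxE; apply: eq_bigr => i _; rewrite mxE.
rewrite /feature_form dot_suml; apply: eq_bigr => i _.
rewrite dot_suml; apply: eq_bigr => j _.
rewrite dotZl; congr (_ * _).
rewrite dot_sumr mxE.
under eq_bigr => k _ do rewrite dot_sumr.
rewrite exchange_big; apply: eq_bigr => l _; rewrite mxE mulr_suml.
apply: eq_bigr => k _; rewrite dotZr (tens_dot tensP) -!rkernelE !mxE.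
by rewrite !rkernelE [dot (ksec (x j)) _]dotC; ring.
Qed.

Lemma feval_sum {Z : Type} {K : rkhsType R Z} {I : finType} (F : I -> K) z :
  feval (\sum_i F i) z = \sum_i feval (F i) z.
Proof.
by rewrite reproducing dot_suml; under eq_bigr do rewrite -reproducing.
Qed.

Lemma fevalZ {Z : Type} {K : rkhsType R Z} (a : R) (f : K) z :
  feval (a *: f) z = a * feval f z.
Proof. by rewrite !reproducing dotZl. Qed.

(** Elements of [H] are determined by their values, and [tens_feval] gives those of [tens]. At
    [(x', y')] both sides become the same product [b QY G QX^T a], bracketed differently. *)
Lemma feature_form_low_rank {mX mY : nat} (QX : 'M[R]_(n, mX))
    (QY : 'M[R]_(n, mY)) (G : 'M[R]_(mY, mX)) :
  feature_form tens x y (QY *m G *m QX^T) =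
  \sum_j \sum_i G j i *: tens (feature_row HX x QX i) (feature_row HY y QY j).
Proof.
apply: feval_inj; apply: funext => -[x' y'].
pose a := \col_k rkernel HX (x k) x' : 'cV[R]_n.
pose b := \row_k rkernel HY (y k) y' : 'rV[R]_n.
have form k l (v : 'rV[R]_k) (M : 'M[R]_(k, l)) (w : 'cV[R]_l) :
    \sum_i \sum_j M i j * (v 0 i * w j 0) = (v *m M *m w) 0 0.
  rewrite exchange_big mxE; apply: eq_bigr => j _.
  by rewrite mxE mulr_suml; apply: eq_bigr => i _; rewrite mulrCA mulrA.
transitivity ((b *m (QY *m G *m QX^T) *m a) 0 0).
  rewrite -form /feature_form feval_sum; apply: eq_bigr => i _.
  rewrite feval_sum; apply: eq_bigr => j _.
  by rewrite fevalZ (tens_feval tensP) !mxE [in RHS](mulrC (rkernel _ _ _)).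
transitivity (((b *m QY) *m G *m (QX^T *m a)) 0 0).
  by rewrite !mulmxA.
rewrite -form feval_sum; apply: eq_bigr => j _.
rewrite feval_sum; apply: eq_bigr => i _.
rewrite fevalZ (tens_feval tensP) !feval_sum [in RHS](mulrC (\sum_k _)) !mxE.
congr (_ * (_ * _)); apply: eq_bigr => k _; rewrite !mxE fevalZ //.
by rewrite mulrC.
Qed.

End Features.

Theorem theorem4p1 (R : realType) (X Y : completeMetricType R)
    (HX : rkhsType R X) (HY : rkhsType R Y) (H : rkhsType R (X * Y)%type)
    (tens : HX -> HY -> H)
    (X_separable : separable_space X) (Y_separable : separable_space Y)
    (HX_separable : separable_space HX) (HY_separable : separable_space HY)
    (tensP : is_tensor_rkhs tens)
    (n : nat) (x : 'I_n -> X) (y : 'I_n -> Y)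
    (tolX tolY eps lambda : R) (mX mY : nat)
    (LX BX : 'M[R]_(n, mX)) (LY BY : 'M[R]_(n, mY))
    (VX : 'M[R]_mX) (VY : 'M[R]_mY) (LamX : 'rV[R]_mX) (LamY : 'rV[R]_mY) :
  let KX := kernel_mx HX x in
  let KY := kernel_mx HY y in
  0 < tolX -> 0 < tolY -> 0 < eps -> 0 < lambda ->
  pivoted_cholesky KX tolX LX BX ->
  pivoted_cholesky KY tolY LY BY ->
  spectral_decomposition (LX^T *m LX) VX LamX ->
  spectral_decomposition (LY^T *m LY) VY LamY ->
  \tr (KX - LX *m LX^T) < eps ->
  \tr (KY - LY *m LY^T) < eps ->
  let QX := BX *m VX in
  let QY := BY *m VY in
  let Phi := feature_form tens x y in
  let F := invmx (KX + (n%:R * lambda)%:M) in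
  let Ft := (LY *m VY)^T *m (LX *m VX) *m
            invmx (diag_mx LamX + (n%:R * lambda)%:M) in
  let muhat := Phi F in
  let mut := Phi (QY *m Ft *m QX^T) in
  let Ht := lin_span [set u | exists (i : 'I_mX) (j : 'I_mY),
                        u = tens (feature_row HX x QX i)
                                 (feature_row HY y QY j)] in
  let FH := (LY *m VY)^T *m F *m (LX *m VX) in
  [/\ orthogonal_projection Ht muhat (Phi (QY *m FH *m QX^T)),
      argmin (fun F' : 'M[R]_(mY, mX) => `|muhat - Phi (QY *m F' *m QX^T)| ^+ 2)
        = [set FH]
    & `|muhat - mut| ^+ 2 <=
        eps * frobenius_norm F ^+ 2 * (\tr KX + \tr KY)
        + frobenius_norm (FH - Ft) ^+ 2].
Proof.
move=> KX KY tolX_gt0 tolY_gt0 _ _ cholX cholY [VVX _] [VVY _] trX trY.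
move=> QX QY Phi F Ft muhat mut Ht FH.
have psdX : psd KX by exact: kernel_mx_psd.
have psdY : psd KY by exact: kernel_mx_psd.
have [KBX BLX] := pivoted_cholesky_inv psdX (ltW tolX_gt0) cholX.
have [KBY BLY] := pivoted_cholesky_inv psdY (ltW tolY_gt0) cholY.
have KQX : KX *m QX = LX *m VX by rewrite mulmxA KBX.
have QLX : QX^T *m (LX *m VX) = 1%:M.
  by rewrite trmx_mul mulmxA -(mulmxA VX^T) BLX mulmx1.
have QKY : QY^T *m KY = (LY *m VY)^T by rewrite -psdY.1 -trmx_mul mulmxA KBY.
have QLY : QY^T *m (LY *m VY) = 1%:M.
  by rewrite trmx_mul mulmxA -(mulmxA VY^T) BLY mulmx1.
have LQY : (LY *m VY)^T *m QY = 1%:M.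
  by rewrite -[RHS]trmx1 -QLY [RHS]trmx_mul trmxK.
(* From here on [QX] and [QY] enter only through the five identities just proved. *)
clearbody QX QY.
(* For [M = F] the matrix paired with [G] is [FH], which is where its formula comes from. *)
have dotE (G : 'M[R]_(mY, mX)) (M : 'M[R]_n) :
    dot (Phi (QY *m G *m QX^T)) (Phi M) =
    \tr (G^T *m ((LY *m VY)^T *m M *m (LX *m VX))).
  rewrite (dot_feature_form tensP) -/KX -/KY -QKY -KQX.
  by rewrite trmx_mul trmxK [(QY *m G)^T]trmx_mul -!mulmxA mxtrace_mulC
    -!mulmxA.
have dotEE (G G' : 'M[R]_(mY, mX)) :
    dot (Phi (QY *m G *m QX^T)) (Phi (QY *m G' *m QX^T)) = \tr (G^T *m G').
  by rewrite dotE -!mulmxA (mulmxA _ QY) LQY mul1mx QLX mulmx1.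
have dot_res (G : 'M[R]_(mY, mX)) :
    dot (muhat - Phi (QY *m FH *m QX^T)) (Phi (QY *m G *m QX^T)) = 0.
  by rewrite dotC dotBr [dot _ muhat]dotE dotEE subrr.
have ortho : orthogonal_projection Ht muhat (Phi (QY *m FH *m QX^T)).
  split=> [|_ [k [c [a [aP ->]]]]].
    rewrite /Phi (feature_form_low_rank tensP) pair_big /=.
    (* [lin_span] asks for a single sum over ordinals, so the double sum is enumerated by pairs,
       with the [Y] index first. *)
    exists #|{: 'I_mY * 'I_mX}|.
    exists (fun k => FH (enum_val k).1 (enum_val k).2).
    exists (fun k => tens (feature_row HX x QX (enum_val k).2)
                          (feature_row HY y QY (enum_val k).1)).
    split; first by move=> k; exists (enum_val k).2, (enum_val k).1.
    by rewrite (reindex (@enum_val _ predT)) //; exact/onW_bij/enum_val_bij.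
  rewrite dot_sumr big1// => l _; rewrite dotZr; have [i [j ->]] := aP l.
  (* Each generator is the image of an elementary matrix, so [dot_res] applies to it. *)
  have -> : tens (feature_row HX x QX i) (feature_row HY y QY j) =
      Phi (QY *m delta_mx j i *m QX^T).
    rewrite /Phi (feature_form_low_rank tensP) (bigD1 j)//= (bigD1 i)//=.
    rewrite mxE !eqxx scale1r [X in _ + X + _]big1 => [|i' /negPf i'i].
      rewrite addr0 big1 ?addr0// => j' /negPf j'j.
      by rewrite big1// => i' _; rewrite mxE j'j scale0r.
    by rewrite mxE i'i andbF scale0r.
  by rewrite dot_res mulr0.
(* Pythagoras: the difference of the images of [FH] and [G] is the image of [FH - G], orthogonal to
   the residual of [muhat]. *)
have normE (G : 'M[R]_(mY, mX)) :
    `|muhat - Phi (QY *m G *m QX^T)| ^+ 2 =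
    `|muhat - Phi (QY *m FH *m QX^T)| ^+ 2 + frobenius_norm (FH - G) ^+ 2.
  have PhiB : Phi (QY *m FH *m QX^T) - Phi (QY *m G *m QX^T) =
      Phi (QY *m (FH - G) *m QX^T).
    by rewrite -feature_formB mulmxBr mulmxBl.
  rewrite -(subrKA (Phi (QY *m FH *m QX^T))) PhiB sqr_normD dot_res mulr0 addr0.
  by rewrite (sqr_norm_dot (Phi _)) dotEE -frobenius_norm_sqr.
split=> //.
  (* A minimizer [G] compared with [FH] has [frobenius_norm (FH - G) ^+ 2 <= 0], whence
     uniqueness. *)
  apply/seteqP; split=> [G /(_ FH)|_ -> G].
    rewrite (normE G) (normE FH) (subrr FH).
    have -> : frobenius_norm (0 : 'M[R]_(mY, mX)) ^+ 2 = 0.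
      by rewrite frobenius_norm_sqr mulmx0 mxtrace0.
    rewrite addr0 gerDl => /frobenius_norm_eq0/eqP.
    by rewrite subr_eq0 => /eqP.
  by rewrite (normE G) lerDl sqr_ge0.
(* Pythagoras at [Ft] cancels the last term and leaves the squared projection error to be
   bounded. *)
rewrite normE lerD2r.
have VVX' : VX *m VX^T = 1%:M by exact: mulmx1C.
have VVY' : VY *m VY^T = 1%:M by exact: mulmx1C.
have -> : `|muhat - Phi (QY *m FH *m QX^T)| ^+ 2 =
    \tr (F^T *m (KY - LY *m LY^T) *m F *m KX) +
    \tr (F^T *m (LY *m LY^T) *m F *m (KX - LX *m LX^T)).
  (* Pythagoras at the zero matrix expresses the projection error as the squared norm of [muhat]
     minus that of [FH]. *)
  have : `|muhat - Phi (QY *m 0 *m QX^T)| ^+ 2 = \tr (F^T *m KY *m F *m KX).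
    rewrite mulmx0 mul0mx -feature_formB subr0 sqr_norm_dot.
    exact: dot_feature_form.
  rewrite normE subr0 => /(canRL (addrK _)) ->.
  (* The orthogonal factors cancel through [V V^T = 1]. *)
  have -> : frobenius_norm FH ^+ 2 =
      \tr (F^T *m (LY *m LY^T) *m F *m (LX *m LX^T)).
    rewrite frobenius_norm_sqr /FH !trmx_mul !trmxK -!mulmxA mxtrace_mulC.
    rewrite -!mulmxA (mulmxA VY) VVY' mul1mx mxtrace_mulC -!mulmxA.
    by rewrite (mulmxA VX) VVX' mul1mx !mulmxA.
  have trB (A B : 'M[R]_n) : \tr (A - B) = \tr A - \tr B by exact: linearB.
  by rewrite mulmxBr !mulmxBl trB mulmxBr trB addrA subrK.
have trLY : \tr (LY *m LY^T) <= \tr KY.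
  have := psd_tr_ge0 (psd_residual psdY KBY BLY).
  by rewrite linearB /= subr_ge0.
have F_ge0 := sqr_ge0 (frobenius_norm F).
(* The [Y] residual is paired with [tr KX], and the [X] residual with [tr (LY LY^T)], itself at most
   [tr KY]. *)
rewrite mulrDr; apply: lerD.
  apply: le_trans (psd_tr_sandwich_le F (psd_residual psdY KBY BLY) psdX) _.
  by rewrite ler_wpM2r ?psd_tr_ge0// ler_wpM2r// ltW.
apply: le_trans
  (psd_tr_sandwich_le F (psd_mul_tr LY) (psd_residual psdX KBX BLX)) _.
rewrite [leRHS]mulrC [leRHS]mulrA [leRHS]mulrAC ler_pM//.
- by rewrite mulr_ge0// psd_tr_ge0//; exact: psd_mul_tr.
- exact: psd_tr_ge0 (psd_residual psdX KBX BLX).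
- by rewrite ler_wpM2r.
- exact: ltW.
Qed.
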